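(* Let $F$ be a conic pseudo-Finsler metric on a surface and let $\overline F=e^{\phi}F$ be a proper anisotropic conformal change of $F$. Then: (i) If $F$ is a Landsberg metric and the change satisfies the vertical $\phi T$-condition, then $F$ is Berwaldian. (ii) If $\overline F$ is a Landsberg metric and the change satisfies the vertical $\phi\overline T$-condition, then $\overline F$ is Berwaldian.
   Context: $M$ is a smooth 2-dimensional manifold with local coordinates $(x^i)$ and induced coordinates $(x^i,y^i)$ on $TM$; $\partial_i=\partial/\partial x^i$, $\dot\partial_i=\partial/\partial y^i$. $\mathcal A\subset TM_0=TM\setminus(0)$ is a conic sub-bundle (non-empty, open, invariant under $y\mapsto\lambda y$, $\lambda>0$, projecting onto $M$). A function is $h(r)$ if it is positively homogeneous of degree $r$ in $y$. A conic pseudo-Finsler metric is a smooth $h(1)$ function $F:\mathcal A\to\mathbb R$ with $g_{ij}=\frac12\dot\partial_i\dot\partial_jF^2$ non-degenerate. Modified Berwald frame: $\ell_i=\dot\partial_iF$, $\ell^i=y^i/F$, $g_{ij}=\ell_i\ell_j+\varepsilon m_im_j$ with $\varepsilon=\pm1$, $m^i=g^{ij}m_j$. Spray coefficients: $G^i=\frac14g^{ik}(y^m\partial_m\dot\partial_kF^2-\partial_kF^2)$; $G^j_i=\dot\partial_iG^j$; $\delta_i=\partial_i-G^j_i\dot\partial_j$. The main scalar $\mathcal I$ is defined by $FC_{ijk}=\mathcal I m_im_jm_k$, where $C_{ijk}=\frac12\dot\partial_kg_{ij}$. For smooth $f$ on $\mathcal A$: $F\dot\partial_if=f_{;1}\ell_i+f_{;2}m_i$,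 $\delta_if=f_{,1}\ell_i+f_{,2}m_i$. The $T$-tensor of $F$ is given by $FT_{ijkh}=\mathcal I_{;2}m_im_jm_km_h$, and $FT^i_{jkr}=\mathcal I_{;2}m^im_jm_km_r$. An anisotropic conformal change of $F$ is $\overline F=e^{\phi(x,y)}F$ with $\phi$ a smooth $h(0)$ function on $\mathcal A$ such that $\varepsilon+\sigma-(\phi_{;2})^2\ne0$, where $\sigma=\phi_{;2;2}+\varepsilon\mathcal I\phi_{;2}+2(\phi_{;2})^2$. It is proper if $\phi_{;2}\neq0$. With $\rho=\frac{1}{\sigma+\varepsilon-(\phi_{;2})^2}$, the frame of $\overline F$ is taken with the same sign $\varepsilon$, $\overline m_i=e^{\phi}\sqrt{\varepsilon/\rho}\,m_i$; bars denote objects associated with $\overline F$. A proper change satisfies the vertical $\phi T$-condition if $(\dot\partial_i\phi)T^i_{jkr}=0$, and the vertical $\phi\overline T$-condition if $(\dot\partial_i\phi)\overline T^i_{jkr}=0$. $F$ is Landsberg iff $\mathcal I_{,1}=0$ and Berwaldian iff $\mathcal I_{,1}=\mathcal I_{,2}=0$; likewise for $\overline F$ with $\overline{\mathcal I}$ and the horizontal scalar derivatives of $\overline F$. *)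

(* Defs.v *)
From HB Require Import structures.
From mathcomp Require Import all_boot all_order all_algebra.
From mathcomp Require Import all_classical all_reals all_analysis.

Set Implicit Arguments.
Unset Strict Implicit.
Unset Printing Implicit Defensive.

Import Order.TTheory GRing.Theory Num.Theory.
Import numFieldNormedType.Exports.

Local Open Scope classical_set_scope.
Local Open Scope ring_scope.

(* C^oo on A: every iterated directional derivative (of any order, including 0)
   is Frechet differentiable, hence continuous, at every point of A.  For A open
   in a finite-dimensional space this is the usual smoothness. *)
Definition smooth_on (R : realType) (V W : normedModType R) (A : set V)
    (f : V -> W) : Prop :=
  forall (s : seq V) (p : V), A p ->
    differentiable (foldr (fun v (h : V -> W) => 'D_v h) f s) p.

(* A smooth structure on a surface M, given by an atlas.  [coord c] is only
   meaningful on [dom c] and [param c], its inverse, only on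
   [coord c @` dom c].  [chart_at p] is one chart around p. *)
Record smooth_surface (R : realType) (M : topologicalType) := SmoothSurface {
  surface_hausdorff : hausdorff_space M;
  surface_second_countable : @second_countable M;
  chart : Type;
  dom : chart -> set M;
  coord : chart -> M -> 'rV[R]_2;
  param : chart -> 'rV[R]_2 -> M;
  chart_at : M -> chart;
  dom_chart_at : forall p, dom (chart_at p) p;
  dom_open : forall c, open (dom c);
  coord_open : forall c, open (coord c @` dom c);
  coordK : forall c p, dom c p -> param c (coord c p) = p;
  coord_continuous : forall c p, dom c p -> {for p, continuous (coord c)};
  param_continuous : forall c x, (coord c @` dom c) x ->
    {for x, continuous (param c)};
  transition_smooth : forall c d,
    smooth_on (coord c @` (dom c `&` dom d)) (coord d \o param c)
}.

Arguments chart {R M} _.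

(* TM: a tangent vector at p is represented by its components in the chart
   [chart_at p]. *)
Definition tangent (R : realType) (M : topologicalType) : Type :=
  (M * 'rV[R]_2)%type.

(* Induced coordinates (x, y) on TM: p.1 = x, p.2 = y. *)
Notation pt R := ('rV[R]_2 * 'rV[R]_2)%type.

(* The tangent vector with induced coordinates q in the chart c: the components
   q.2 are transformed by the Jacobian of the change of coordinates. *)
Definition tangent_of (R : realType) (M : topologicalType)
    (S : smooth_surface R M) (c : chart S) (q : pt R) : tangent R M :=
  let p := param c q.1 in
  (p, 'd (coord (chart_at S p) \o param c) (q.1) (q.2)).

Definition set_in_chart (R : realType) (M : topologicalType)
    (S : smooth_surface R M) (c : chart S) (A : set (tangent R M)) :
    set (pt R) :=
  [set q | (coord c @` dom c) q.1 /\ A (tangent_of c q)].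

Definition in_chart (R : realType) (M : topologicalType)
    (S : smooth_surface R M) (c : chart S) (f : tangent R M -> R) : pt R -> R :=
  f \o tangent_of c.

Section Coordinates.
Variable R : realType.
Implicit Types (F f phi eps : pt R -> R) (m : pt R -> 'rV[R]_2) (p : pt R).

Definition d_x (i : 'I_2) f : pt R -> R := 'D_((delta_mx 0 i, 0) : pt R) f.
Definition d_y (i : 'I_2) f : pt R -> R := 'D_((0, delta_mx 0 i) : pt R) f.

Definition metric F p : 'M[R]_2 :=
  \matrix_(i, j) (2^-1 * d_y i (d_y j (fun q => F q ^+ 2)) p).

Definition ell F (i : 'I_2) p : R := d_y i F p.

Definition cartan F (i j k : 'I_2) p : R :=
  2^-1 * d_y k (fun q => metric F q i j) p.

Definition spray F (i : 'I_2) p : R :=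
  4^-1 * \sum_k invmx (metric F p) i k *
    (\sum_l p.2 0 l * d_x l (d_y k (fun q => F q ^+ 2)) p
     - d_x k (fun q => F q ^+ 2) p).

(* G^j_i *)
Definition nonlinear_connection F (j i : 'I_2) : pt R -> R := d_y i (spray F j).

Definition delta F (i : 'I_2) f p : R :=
  d_x i f p - \sum_j nonlinear_connection F j i p * d_y j f p.

(* The (unique, if l_i and m_i are independent) pair (a, b) such that
   w_i = a l_i + b m_i. *)
Definition frame_components F m (w : 'I_2 -> R) p : R * R :=
  xget (0, 0) [set ab : R * R |
    forall i, w i = ab.1 * ell F i p + ab.2 * m p 0 i].

(* f_{;1}, f_{;2}, f_{,1}, f_{,2} *)
Definition vder1 F m f p : R :=
  (frame_components F m (fun i => F p * d_y i f p) p).1.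
Definition vder2 F m f p : R :=
  (frame_components F m (fun i => F p * d_y i f p) p).2.
Definition hder1 F m f p : R :=
  (frame_components F m (fun i => delta F i f p) p).1.
Definition hder2 F m f p : R :=
  (frame_components F m (fun i => delta F i f p) p).2.

Definition main_scalar F m p : R :=
  xget 0 [set t : R | forall i j k : 'I_2,
    F p * cartan F i j k p = t * m p 0 i * m p 0 j * m p 0 k].

(* m^i *)
Definition m_up F m (i : 'I_2) p : R :=
  \sum_j invmx (metric F p) i j * m p 0 j.

(* T^i_{jkr} *)
Definition T_tensor F m (i j k r : 'I_2) p : R :=
  (F p)^-1 * (vder2 F m (main_scalar F m) p *
    m_up F m i p * m p 0 j * m p 0 k * m p 0 r).

Definition sigma F eps m phi p : R :=
  vder2 F m (vder2 F m phi) p + eps p * main_scalar F m p * vder2 F m phi p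
  + 2 * vder2 F m phi p ^+ 2.

Definition rho F eps m phi p : R :=
  (sigma F eps m phi p + eps p - vder2 F m phi p ^+ 2)^-1.

(* Frame of exp(phi) F.  The sign is eps wherever eps / rho > 0; where
   eps / rho < 0 the square root of eps / rho is not real, exp(phi) F has the
   opposite signature, and its sign is - eps. *)
Definition eps_bar F eps m phi p : R :=
  if 0 < eps p / rho F eps m phi p then eps p else - eps p.

Definition m_bar F eps m phi p : 'rV[R]_2 :=
  (expR (phi p) * Num.sqrt (eps_bar F eps m phi p / rho F eps m phi p)) *: m p.

End Coordinates.

Section Surface.
Variables (R : realType) (M : topologicalType) (S : smooth_surface R M).
Variable A : set (tangent R M).
Implicit Types (F phi : tangent R M -> R).
Implicit Types (eps : chart S -> pt R -> R) (m : chart S -> pt R -> 'rV[R]_2).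

Definition conic_subbundle : Prop :=
  [/\ A !=set0,
      forall c : chart S, open (set_in_chart c A),
      forall x y, A (x, y) -> y != 0,
      forall x y (l : R), 0 < l -> A (x, y) -> A (x, l *: y)
    & forall x, exists y, A (x, y)].

Definition smooth_scalar (f : tangent R M -> R) : Prop :=
  forall c : chart S, smooth_on (set_in_chart c A) (in_chart c f).

Definition homogeneous (r : nat) (f : tangent R M -> R) : Prop :=
  forall x y (l : R), 0 < l -> A (x, y) -> f (x, l *: y) = l ^+ r * f (x, y).

Definition conic_pseudo_finsler F : Prop :=
  [/\ smooth_scalar F, homogeneous 1 F
    & forall (c : chart S) q, set_in_chart c A q ->
        metric (in_chart c F) q \in unitmx].

(* A modified Berwald frame in each chart.  As m is determined by F only up to
   sign, a global m need not exist; eps may a priori depend on the point, as A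
   need not be connected. *)
Definition berwald_frame F eps m : Prop :=
  forall c : chart S,
    smooth_on (set_in_chart c A) (m c) /\
    forall q, set_in_chart c A q ->
      (eps c q = 1 \/ eps c q = -1) /\
      forall i j : 'I_2, metric (in_chart c F) q i j =
        ell (in_chart c F) i q * ell (in_chart c F) j q
        + eps c q * m c q 0 i * m c q 0 j.

Definition conformal_change F phi : tangent R M -> R :=
  fun u => expR (phi u) * F u.

Definition anisotropic_conformal_change F eps m phi : Prop :=
  [/\ smooth_scalar phi, homogeneous 0 phi
    & forall (c : chart S) q, set_in_chart c A q ->
        eps c q + sigma (in_chart c F) (eps c) (m c) (in_chart c phi) q
        - vder2 (in_chart c F) (m c) (in_chart c phi) q ^+ 2 != 0].

Definition proper_change F m phi : Prop :=
  forall (c : chart S) q, set_in_chart c A q ->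
    vder2 (in_chart c F) (m c) (in_chart c phi) q != 0.

Definition changed_m F eps m phi : chart S -> pt R -> 'rV[R]_2 :=
  fun c => m_bar (in_chart c F) (eps c) (m c) (in_chart c phi).

(* For the metric F with frame covector m; it is used both for F and for
   exp(phi) F. *)
Definition vertical_T_condition F m phi : Prop :=
  forall (c : chart S) q, set_in_chart c A q -> forall j k r : 'I_2,
    \sum_i d_y i (in_chart c phi) q * T_tensor (in_chart c F) (m c) i j k r q
    = 0.

Definition landsberg F m : Prop :=
  forall (c : chart S) q, set_in_chart c A q ->
    hder1 (in_chart c F) (m c) (main_scalar (in_chart c F) (m c)) q = 0.

Definition berwaldian F m : Prop :=
  forall (c : chart S) q, set_in_chart c A q ->
    hder1 (in_chart c F) (m c) (main_scalar (in_chart c F) (m c)) q = 0 /\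
    hder2 (in_chart c F) (m c) (main_scalar (in_chart c F) (m c)) q = 0.

End Surface.

(* Main.v *)
Require Import Defs.
From mathcomp Require Import all_boot all_order all_algebra.
From mathcomp Require Import all_classical all_reals all_analysis.
From HB Require Import structures.
From mathcomp Require Import ring lra.

Set Implicit Arguments.
Unset Strict Implicit.
Unset Printing Implicit Defensive.

Import Order.TTheory GRing.Theory Num.Theory.
Import numFieldNormedType.Exports.

Local Open Scope classical_set_scope.
Local Open Scope ring_scope.

(** The theorem is local, and is proved in one chart at a time, where [F] is a
    function on a conic open set [U] of induced coordinates [(x, y)]; the data
    retained there are gathered in [berwald_chart].

    Part (i). As [phi] is homogeneous of degree 0, [F d_i phi = phi_{;2} m_i]
    for the vertical derivatives [d_i], with [phi_{;2} <> 0] for a proper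
    change. Since [m_i m^i = eps <> 0], the vertical condition says exactly that
    [I_{;2} = 0]. The main scalar [I] is itself homogeneous of degree 0, so all
    its vertical derivatives vanish ([d_y_main_scalar_eq0]) and [I] is locally
    a function of [x] alone. Then [delta_i I] reduces to the horizontal partial
    derivative of [I], whatever the spray is, and does not depend on [y] locally
    ([derive_cst_along]). The Landsberg equation is the vanishing of its
    contraction with [y]; as it holds for all [y] in an open set, the horizontal
    derivatives of [I] vanish ([d_x_main_scalar_eq0]), and so does [I_{,2}].

    Part (ii) is part (i) for the metric [exp(phi) F] with the covector [m_bar]:
    what has to be shown is that [m_bar] is a modified Berwald frame of it
    ([berwald_chart_conformal]). This rests on the identity
    [g_ij - l_i l_j = exp(2 phi) (sigma + eps - phi_{;2} ^ 2) m_i m_j], with [g]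
    and [l] those of [exp(phi) F] on the left hand side ([gij_conformal]). It
    follows by differentiating [l_i + phi_{;2} m_i] with the structure equations
    [F d_k l_i = eps m_k m_i] and [F d_k m_i = eps I m_k m_i - m_k l_i]
    ([F_d_y_ell] and [F_d_y_m]).

    The structure equations also show that a scalar [I] with
    [F C_ijk = I m_i m_j m_k] exists. The symmetry of the mixed second
    derivatives of [F ^ 2] is nowhere established separately: for the vertical
    ones, it is contained in [g_ij = l_i l_j + eps m_i m_j]. *)

(** * Differentiable and smooth scalar functions *)

Section Calculus.
Variables (R : realType) (V : normedModType R).
Implicit Types (U : set V) (f g : V -> R) (p v : V).

Lemma differentiable_near0 f p :
  (\forall q \near p, f q = 0) -> differentiable f p.
Proof.
move=> f0; have fp0 : f p = 0 by exact: nbhs_singleton f0.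
have near0 : \forall h \near (0 : V), f (h + p) = 0.
  by move: f0; rewrite (near_shift 0) /=; apply: filterS => h; rewrite subr0.
have ef : f \o shift p = cst (f p) + (\0 : V -> R) +o_ (0 : V) id.
  apply/eqaddoP => _/posnumP[e]; near=> h.
  rewrite !fctE /= fp0 addr0 subr0 (_ : f _ = 0) ?normr0 ?mulr_ge0//.
  by near: h.
have c0 : continuous (\0 : V -> R) by move=> x; exact: cst_continuous.
have d0 : 'd f p = \0 :> (V -> R) by exact: diff_unique ef.
by apply/diff_locallyP; rewrite d0.
Unshelve. all: by end_near. Qed.

Lemma differentiable_near_eq f g p :
  (\forall q \near p, f q = g q) -> differentiable f p -> differentiable g p.
Proof.
move=> fg df; have -> : g = f + (g - f) by apply/funext => q; rewrite !fctE; ring.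
apply: differentiableD => //; apply: differentiable_near0.
by apply: filterS fg => q e; rewrite !fctE e subrr.
Qed.

Lemma near_neq0 f p : differentiable f p -> f p != 0 ->
  \forall q \near p, f q != 0.
Proof.
move=> /differentiable_continuous cf f0.
exact: (cf _ (open_nbhs_nbhs (conj (@open_neq R 0) f0))).
Qed.

Lemma near_gt0 f p : differentiable f p -> 0 < f p ->
  \forall q \near p, 0 < f q.
Proof.
move=> /differentiable_continuous cf f0.
exact: (cf _ (open_nbhs_nbhs (conj (@open_gt R 0) f0))).
Qed.

Lemma differentiable_mul f g p : differentiable f p -> differentiable g p ->
  differentiable (fun q => f q * g q) p.
Proof. exact: differentiableM. Qed.

Lemma derive_mul f g p v : differentiable f p -> differentiable g p ->
  'D_v (fun q => f q * g q) p = f p * 'D_v g p + g p * 'D_v f p.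
Proof.
by move=> df dg; rewrite -[LHS]/('D_v (f * g) p) deriveM//; exact: diff_derivable.
Qed.

Lemma differentiable_expR f p :
  differentiable f p -> differentiable (fun q => expR (f q)) p.
Proof.
move=> df; apply: (differentiable_comp (g := @expR R)) => //.
by apply/derivable1_diffP; exact: derivable_expR.
Qed.

Lemma derive_expR_comp f p v : differentiable f p ->
  'D_v (fun q => expR (f q)) p = expR (f p) * 'D_v f p.
Proof.
move=> df.
have de : differentiable (@expR R) (f p).
  by apply/derivable1_diffP; exact: derivable_expR.
rewrite !deriveE//; last exact: differentiable_expR.
rewrite -[fun q => _]/(expR \o f) diff_comp//=.
by rewrite deriv1E ?derivable_expR// derive1E derive_val mulrC.
Qed.

(** All iterated directional derivatives of order at most [n] are
    differentiable on [U]: the finite order version of [smooth_on], on which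
    the stability of smoothness is proved by induction. *)
Definition smooth_upto n U f : Prop :=
  forall s : seq V, (size s <= n)%N -> forall p, U p ->
    differentiable (foldr (fun v (h : V -> R) => 'D_v h) f s) p.

Lemma smooth_onP U f : smooth_on U f <-> forall n, smooth_upto n U f.
Proof.
split=> [sf n s _|sf s p]; first exact: sf.
exact: (sf (size s)).
Qed.

Lemma smooth_upto_diff n U f p : smooth_upto n U f -> U p -> differentiable f p.
Proof. by move=> sf; exact: (sf [::]). Qed.

Lemma smooth_upto_derive n U f v :
  smooth_upto n.+1 U f -> smooth_upto n U ('D_v f).
Proof.
move=> sf s sn p Up; have := sf (rcons s v) _ p Up.
by rewrite size_rcons ltnS foldr_rcons; exact.
Qed.

Lemma smooth_uptoS n U f : smooth_upto n.+1 U f -> smooth_upto n U f.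
Proof. by move=> sf s sn; apply: sf; exact: leqW. Qed.

Lemma smooth_upto_eq n U f g : open U -> (forall p, U p -> f p = g p) ->
  smooth_upto n U f -> smooth_upto n U g.
Proof.
move=> oU fg sf s sn p Up.
have eq_on (t : seq V) q : U q -> foldr (fun v (h : V -> R) => 'D_v h) f t q =
    foldr (fun v (h : V -> R) => 'D_v h) g t q.
  elim: t q => [|w t IH] q Uq /=; first exact: fg.
  by apply: near_eq_derive; near=> r; apply: IH; near: r; exact: open_nbhs_nbhs.
apply: (differentiable_near_eq _ (sf s sn p Up)).
by near=> q; apply: eq_on; near: q; exact: open_nbhs_nbhs.
Unshelve. all: by end_near. Qed.

Lemma smooth_upto_ind n U f : (forall p, U p -> differentiable f p) ->
  (forall v, smooth_upto n U ('D_v f)) -> smooth_upto n.+1 U f.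
Proof.
move=> df sDf; elim/last_ind => [_ //|s v _]; rewrite size_rcons ltnS foldr_rcons.
exact: sDf.
Qed.

Lemma smooth_uptoD n U f g : open U -> smooth_upto n U f -> smooth_upto n U g ->
  smooth_upto n U (fun q => f q + g q).
Proof.
move=> oU; elim: n f g => [|n IH] f g sf sg.
  case=> // _ p Up /=.
  by apply: differentiableD; [exact: smooth_upto_diff sf _|exact: smooth_upto_diff sg _].
apply: smooth_upto_ind => [p Up|v].
  by apply: differentiableD; [exact: smooth_upto_diff sf _|exact: smooth_upto_diff sg _].
apply: (smooth_upto_eq oU (f := fun q => 'D_v f q + 'D_v g q)) => [p Up|].
  have df := smooth_upto_diff sf Up; have dg := smooth_upto_diff sg Up.
  rewrite -[RHS]/('D_v (f + g) p) deriveD//; exact: diff_derivable.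
by apply: IH; exact: smooth_upto_derive.
Qed.

Lemma smooth_uptoM n U f g : open U -> smooth_upto n U f -> smooth_upto n U g ->
  smooth_upto n U (fun q => f q * g q).
Proof.
move=> oU; elim: n f g => [|n IH] f g sf sg.
  case=> // _ p Up /=.
  by apply: differentiableM; [exact: smooth_upto_diff sf _|exact: smooth_upto_diff sg _].
apply: smooth_upto_ind => [p Up|v].
  by apply: differentiableM; [exact: smooth_upto_diff sf _|exact: smooth_upto_diff sg _].
apply: (smooth_upto_eq oU (f := fun q => f q * 'D_v g q + g q * 'D_v f q)).
  move=> p Up; rewrite derive_mul//.
    exact: smooth_upto_diff sf _.
  exact: smooth_upto_diff sg _.
by apply: smooth_uptoD => //; apply: IH;
  do ?[exact: smooth_uptoS|exact: smooth_upto_derive].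
Qed.

Lemma smooth_upto_expR n U f : open U -> smooth_upto n U f ->
  smooth_upto n U (fun q => expR (f q)).
Proof.
move=> oU; elim: n f => [|n IH] f sf.
  by case=> // _ p Up /=; apply: differentiable_expR; exact: smooth_upto_diff sf _.
have df p (Up : U p) := smooth_upto_diff sf Up.
apply: smooth_upto_ind => [p Up|v]; first by apply: differentiable_expR; exact: df.
apply: (smooth_upto_eq oU (f := fun q => expR (f q) * 'D_v f q)).
  by move=> p Up; rewrite derive_expR_comp//; exact: df.
apply: smooth_uptoM => //; last exact: smooth_upto_derive.
by apply: IH; exact: smooth_uptoS.
Qed.

Lemma smooth_on_diff U f p : smooth_on U f -> U p -> differentiable f p.
Proof. by move=> sf; exact: (sf [::]). Qed.

Lemma smooth_on_derive U f v : smooth_on U f -> smooth_on U ('D_v f).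
Proof.
by move=> /smooth_onP sf; apply/smooth_onP => n; exact: smooth_upto_derive.
Qed.

Lemma smooth_on_cst U (c : R) : smooth_on U (fun=> c).
Proof.
apply/smooth_onP => n; elim: n c => [|n IH] c.
  by case=> // _ p Up /=; exact: differentiable_cst.
apply: smooth_upto_ind => [p Up|v]; first exact: differentiable_cst.
by rewrite (_ : 'D_v _ = fun=> 0); [exact: IH|apply/funext => q; exact: derive_cst].
Qed.

Lemma smooth_onM U f g : open U -> smooth_on U f -> smooth_on U g ->
  smooth_on U (fun q => f q * g q).
Proof.
by move=> oU /smooth_onP sf /smooth_onP sg; apply/smooth_onP => n; exact: smooth_uptoM.
Qed.

Lemma smooth_on_expR U f : open U -> smooth_on U f ->
  smooth_on U (fun q => expR (f q)).
Proof.
by move=> oU /smooth_onP sf; apply/smooth_onP => n; exact: smooth_upto_expR.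
Qed.

End Calculus.

(** * Derivatives along lines *)

Section Lines.
Variables (R : realType) (V : normedModType R).
Implicit Types (U : set V) (f : V -> R) (p v u w : V).

Lemma is_derive_line f p v (t : R) : differentiable f (t *: v + p) ->
  is_derive t 1 (fun s : R => f (s *: v + p)) ('D_v f (t *: v + p)).
Proof.
move=> df; pose k (s : R) := s *: v + p.
have dk : differentiable k t.
  apply: differentiableD; last exact: differentiable_cst.
  exact: differentiableZl.
have kE : 'D_1 k t = v.
  rewrite deriveD; [|exact/diff_derivable/differentiableZl|exact: derivable_cst].
  rewrite derive_cst addr0 deriveE; last exact: differentiableZl.
  rewrite diffZl//.
  have -> : 'd (id : R -> R) t = id :> (R -> R) by exact: diff_val.
  by rewrite scale1r.
have dfk : differentiable (f \o k) t by exact: differentiable_comp.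
apply: DeriveDef; first exact: diff_derivable.
by rewrite -[fun s => _]/(f \o k) deriveE// diff_comp//= -(deriveE (1 : R) dk) kE deriveE.
Qed.

Lemma derive_line0 f p v : differentiable f p ->
  'D_1 (fun s : R => f (s *: v + p)) 0 = 'D_v f p.
Proof.
move=> df; have := @is_derive_line f p v 0.
by rewrite scale0r add0r => /(_ df) ?; rewrite derive_val.
Qed.

Lemma cst_of_derive0 (g : R -> R) (a b : R) : a <= b ->
  (forall t, t \in `[a, b] -> is_derive t 1 g 0) -> g a = g b.
Proof.
move=> ab dg.
have cg : {within `[a, b], continuous g}.
  apply: derivable_within_continuous => t tab.
  by have ? := dg t tab; exact: ex_derive.
have dg' t : t \in `]a, b[ -> is_derive t 1 g ((fun=> 0) t).
  by move=> /subset_itv_oo_cc; exact: dg.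
have [c _] := MVT_segment ab dg' cg.
rewrite mul0r => /eqP; rewrite subr_eq0 => /eqP; exact: esym.
Qed.

Lemma near_plane U p u w : open U -> U p ->
  exists2 d : R, 0 < d & forall h s : R, `|h| < d -> `|s| < d ->
    U (h *: u + (s *: w + p)).
Proof.
move=> oU Up.
have c : (h.1 *: u + (h.2 *: w + p)) @[h --> ((0, 0) : R * R)] --> p.
  rewrite -[X in _ --> X](_ : (0 : R) *: u + ((0 : R) *: w + p) = p);
    last by rewrite !scale0r !add0r.
  apply: cvgD; first by apply: cvgZr_tmp; exact: cvg_fst.
  apply: cvgD; last exact: cvg_cst.
  by apply: cvgZr_tmp; exact: cvg_snd.
have /nbhs_ballP[d d0 dU] := c _ (open_nbhs_nbhs (conj oU Up)).
exists d => // h s hd sd; apply: (dU (h, s)).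
by split; rewrite /= -ball_normE /= sub0r normrN.
Qed.

(** If the derivative of [f] along [w] vanishes, then the derivative of [f]
    along any other direction [u] is locally constant along [w]; no symmetry of
    second derivatives is involved. *)
Lemma derive_cst_along U f p u w : open U -> (forall q, U q -> differentiable f q) ->
  (forall q, U q -> 'D_w f q = 0) -> U p ->
  \forall s \near (0 : R), 'D_u f (s *: w + p) = 'D_u f p.
Proof.
move=> oU df f0 Up; have [d d0 dU] := near_plane u w oU Up.
have fE (h s : R) : `|h| < d -> `|s| < d ->
    f (h *: u + (s *: w + p)) = f (h *: u + p).
  move=> hd sd.
  pose g (t : R) := f (t *: w + (h *: u + p)).
  have gE t : f (h *: u + (t *: w + p)) = g t by rewrite /g addrCA.
  have dg (t : R) : `|t| < d -> is_derive t 1 g 0.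
    move=> td; have Ut : U (t *: w + (h *: u + p)) by rewrite addrCA; exact: dU.
    by rewrite -(f0 _ Ut); apply: is_derive_line; exact: df.
  have g0 : g 0 = f (h *: u + p) by rewrite /g scale0r add0r.
  rewrite gE -g0; have [s0|s0] := leP 0 s.
    apply: esym; apply: (@cst_of_derive0 g 0 s s0) => t.
    rewrite in_itv/= => /andP[t0 ts]; apply: dg.
    by rewrite ger0_norm//; apply: le_lt_trans ts _; rewrite -(ger0_norm s0).
  apply: cst_of_derive0 => [|t]; first exact: ltW.
  rewrite in_itv/= => /andP[st t0]; apply: dg.
  by rewrite ler0_norm//; apply: le_lt_trans _ sd; rewrite (ltr0_norm s0) lerN2.
near=> s.
have sd : `|s| < d by near: s; exact: (@nbhs0_lt _ R^o).
have z0 : `|0 : R| < d by rewrite normr0.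
have Us : U (s *: w + p) by have := dU 0 s z0 sd; rewrite scale0r add0r.
rewrite -(derive_line0 u (df _ Us)) -(derive_line0 u (df _ Up)).
apply: near_eq_derive; near=> h; apply: fE => //.
Unshelve. all: by end_near. Qed.

End Lines.

(** * Homogeneity in the fibre coordinates *)

Section Fibre.
Variable R : realType.
Implicit Types (U : set (pt R)) (f : pt R -> R) (p q : pt R).

Lemma ord2P (i : 'I_2) : i = 0 \/ i = 1.
Proof. by case: i => [[|[|//]] ?]; [left|right]; exact: val_inj. Qed.

Lemma sum2 (h : 'I_2 -> R) : \sum_i h i = h 0 + h 1.
Proof. by rewrite big_ord_recl big_ord1; congr (_ + h _); exact: val_inj. Qed.

Lemma row2P (w : 'rV[R]_2) :
  w = w 0 0 *: delta_mx 0 0 + w 0 1 *: delta_mx 0 1.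
Proof.
apply/rowP => j; rewrite !mxE.
by case: (ord2P j) => -> /=; rewrite mulr1 mulr0 ?addr0 ?add0r.
Qed.

Lemma derive_y f p (w : 'rV[R]_2) : differentiable f p ->
  'D_(((0 : 'rV[R]_2), w) : pt R) f p = w 0 0 * d_y 0 f p + w 0 1 * d_y 1 f p.
Proof.
move=> df; rewrite /d_y !deriveE//.
have -> : ((0, w) : pt R) = w 0 0 *: ((0, delta_mx 0 0) : pt R) +
    w 0 1 *: ((0, delta_mx 0 1) : pt R).
  by congr pair; rewrite /= ?scaler0 ?addr0// -row2P.
by rewrite linearD !linearZ.
Qed.

(** The fibrewise dilation [(x, y) |-> (x, l y)]. *)
Definition dilate (l : R) p : pt R := (p.1, l *: p.2).

(** Stability under the fibrewise dilations with positive factor. *)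
Definition conic U : Prop := forall p l, U p -> 0 < l -> U (dilate l p).

(** Positive homogeneity of degree [r] in [y], on a set of induced coordinates. *)
Definition homogeneous_on U (r : nat) f : Prop :=
  forall p l, U p -> 0 < l -> f (dilate l p) = l ^+ r * f p.

Lemma euler U r f p : homogeneous_on U r f -> U p -> differentiable f p ->
  p.2 0 0 * d_y 0 f p + p.2 0 1 * d_y 1 f p = r%:R * f p.
Proof.
move=> hf Up df; rewrite -derive_y// -derive_line0//.
have -> : 'D_1 (fun s : R => f (s *: ((0, p.2) : pt R) + p)) 0 =
    'D_1 (fun s : R => (s + 1) ^+ r * f p) 0.
  apply: near_eq_derive; near=> s.
  have s0 : 0 < s + 1.
    have : `|s| < 1 by near: s; exact: (@nbhs0_lt _ R^o).
    by rewrite ltr_norml => /andP[]; lra.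
  rewrite -hf//; congr f; rewrite /dilate; congr pair => /=.
    by rewrite scaler0 add0r.
  by rewrite scalerDl scale1r.
have -> : (fun s : R => (s + 1) ^+ r * f p) = (fun s : R => f p * ((id + cst 1) ^+ r) s).
  by apply/funext => s; rewrite mulrC fctE.
have d1 : derivable ((id : R -> R) + cst 1) 0 1 by exact: derivableD.
rewrite -[fun s => _]/(f p *: ((id : R -> R) + cst 1) ^+ r) deriveZ;
  last exact: derivableX.
rewrite (deriveX r d1) (deriveD _ _); [|exact: derivable_id|exact: derivable_cst].
rewrite derive_id derive_cst !fctE add0r expr1n addr0 /GRing.scale/=.
by rewrite !mulr1 mulrC.
Unshelve. all: by end_near. Qed.

(** A vertical derivative lowers the degree of homogeneity by one; multiplying by
    [l] avoids negative degrees. *)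
Lemma d_y_dilate U r f p l i : open U -> homogeneous_on U r f ->
  (forall q, U q -> differentiable f q) -> conic U -> U p -> 0 < l ->
  l * d_y i f (dilate l p) = l ^+ r * d_y i f p.
Proof.
move=> oU hf df cU Up l0; pose v := ((0, delta_mx 0 i) : pt R).
have Ul := cU p l Up l0.
have lE : d_y i f (dilate l p) = l ^+ r * 'D_(l^-1 *: v) f p.
  rewrite /d_y -(derive_line0 _ (df _ Ul)) -(derive_line0 _ (df _ Up)).
  have [d d0 dU] := near_plane (l^-1 *: v) 0 oU Up.
  transitivity ('D_1 (l ^+ r *: (fun s : R => f (s *: (l^-1 *: v) + p))) 0).
    apply: near_eq_derive; near=> s.
    have sd : `|s| < d by near: s; exact: (@nbhs0_lt _ R^o).
    have z0 : `|0 : R| < d by rewrite normr0.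
    have Us : U (s *: (l^-1 *: v) + p) by have := dU s 0 sd z0; rewrite scaler0 add0r.
    rewrite fctE -[RHS]hf//; congr f; rewrite /dilate; congr pair => /=.
      by rewrite !scaler0 !add0r.
    by rewrite scalerDr !scalerA mulrCA divff ?mulr1// gt_eqF.
  rewrite deriveZ//.
  have := @is_derive_line _ _ f p (l^-1 *: v) 0.
  rewrite scale0r add0r => /(_ (df p Up)) h.
  exact: ex_derive.
have l00 : l != 0 by rewrite gt_eqF.
rewrite lE /d_y !(deriveE _ (df _ Up)) linearZ /GRing.scale/= mulrCA (mulrA l).
by rewrite (divff l00) mul1r.
Unshelve. all: by end_near. Qed.

End Fibre.

(** * The metric tensor in induced coordinates *)

Section Chart.
Variable R : realType.
Implicit Types (f h : pt R -> R) (p q : pt R).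

Lemma d_yM i f h p : differentiable f p -> differentiable h p ->
  d_y i (fun q => f q * h q) p = f p * d_y i h p + h p * d_y i f p.
Proof. exact: derive_mul. Qed.

Lemma d_yD i f h p : differentiable f p -> differentiable h p ->
  d_y i (fun q => f q + h q) p = d_y i f p + d_y i h p.
Proof.
by move=> df dh; rewrite -[LHS]/('D__ (f + h) p) deriveD//; exact: diff_derivable.
Qed.

Lemma d_yZ i (c : R) f p : differentiable f p ->
  d_y i (fun q => c * f q) p = c * d_y i f p.
Proof.
move=> df; rewrite (d_yM i (differentiable_cst c p) df).
by rewrite (derive_cst c p _ : d_y i (fun=> c) p = 0) mulr0 addr0.
Qed.

Lemma d_y_near i f h p : (\forall q \near p, f q = h q) -> d_y i f p = d_y i h p.
Proof. exact: near_eq_derive. Qed.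

Lemma differentiable_y (i : 'I_2) p : differentiable (fun q : pt R => q.2 0 i) p.
Proof.
apply: (differentiable_comp (f := snd) (g := fun w : 'rV[R]_2 => w 0 i)).
  have lin : linear (snd : pt R -> 'rV[R]_2) by [].
  pose linM := GRing.isLinear.Build _ _ _ _ _ lin.
  pose linL : {linear pt R -> 'rV[R]_2} := HB.pack (snd : pt R -> 'rV[R]_2) linM.
  rewrite (_ : snd = linL)//; apply: linear_differentiable => q.
  exact: cvg_snd.
exact: differentiable_coord.
Qed.

Lemma d_y_y (k i : 'I_2) p : d_y k (fun q : pt R => q.2 0 i) p = (i == k)%:R.
Proof.
rewrite /d_y -derive_line0; last exact: differentiable_y.
rewrite (_ : (fun s => _) = ( *:%R^~ ((i == k)%:R : R) + cst (p.2 0 i) : R -> R)).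
  rewrite deriveD; [|exact/diff_derivable/differentiableZl|exact: derivable_cst].
  rewrite derive_cst addr0 deriveE; last exact: differentiableZl.
  by rewrite diffZl// diff_val /= scale1r.
by apply/funext => s; rewrite !mxE eqxx eq_sym.
Qed.

(** Local coordinate form of a conic pseudo-Finsler metric [F] with a modified
    Berwald frame: [U] is a conic open set of induced coordinates, and only the
    differentiability of the components of the covector [m] is retained. *)
Record berwald_chart (U : set (pt R)) (F eps : pt R -> R)
    (m : pt R -> 'rV[R]_2) : Prop := BerwaldChart {
  bc_open : open U;
  bc_conic : conic U;
  bc_slit : forall p, U p -> p.2 != 0;
  bc_smooth : smooth_on U F;
  bc_hom : homogeneous_on U 1 F;
  bc_m : forall p i, U p -> differentiable (fun q => m q 0 i) p;
  bc_unit : forall p, U p -> metric F p \in unitmx;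
  bc_eps : forall p, U p -> eps p = 1 \/ eps p = -1;
  bc_metric : forall p i j, U p ->
    metric F p i j = ell F i p * ell F j p + eps p * m p 0 i * m p 0 j
}.

(** The entry [g_ij] of the metric tensor, as a scalar function. *)
Definition gij (F : pt R -> R) i j p : R :=
  2^-1 * d_y i (d_y j (fun q => F q ^+ 2)) p.

Lemma metric_gij F p i j : metric F p i j = gij F i j p.
Proof. by rewrite mxE. Qed.

Lemma cartan_gij F i j k p : cartan F i j k p = 2^-1 * d_y k (gij F i j) p.
Proof.
by congr (_ * d_y k _ p); apply/funext => q; rewrite metric_gij.
Qed.

Section Geometry.
Variables (U : set (pt R)) (F : pt R -> R).
Hypotheses (oU : open U) (cU : conic U) (sF : smooth_on U F) (hF : homogeneous_on U 1 F).

Let nearU p : U p -> \forall q \near p, U q.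
Proof. by move=> Up; exact: open_nbhs_nbhs. Qed.

Lemma smooth_ell j : smooth_on U (ell F j).
Proof. exact: smooth_on_derive. Qed.

Lemma smooth_sqr : smooth_on U (fun q => F q ^+ 2).
Proof. exact: smooth_onM. Qed.

Lemma smooth_gij i j : smooth_on U (gij F i j).
Proof.
apply: smooth_onM => //; first exact: smooth_on_cst.
by do 2 apply: smooth_on_derive; exact: smooth_sqr.
Qed.

Lemma smooth_cartan i j k : smooth_on U (cartan F i j k).
Proof.
rewrite (_ : cartan F i j k = fun q => 2^-1 * d_y k (gij F i j) q); last first.
  by apply/funext => q; rewrite cartan_gij.
apply: smooth_onM => //; first exact: smooth_on_cst.
by apply: smooth_on_derive; exact: smooth_gij.
Qed.

Lemma d_y_sqr j q : U q -> d_y j (fun q => F q ^+ 2) q = 2 * (F q * ell F j q).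
Proof.
move=> Uq; have dF := smooth_on_diff sF Uq.
by rewrite [LHS](d_yM _ dF dF) /ell; ring.
Qed.

Lemma gijE i j p : U p ->
  gij F i j p = ell F i p * ell F j p + F p * d_y i (ell F j) p.
Proof.
move=> Up; have dF := smooth_on_diff sF Up; have dl := smooth_on_diff (smooth_ell j) Up.
rewrite /gij (@d_y_near _ _ (fun q => 2 * (F q * ell F j q))); last first.
  by apply: filterS (nearU Up) => q; exact: d_y_sqr.
rewrite d_yZ; last exact: differentiable_mul.
rewrite (d_yM _ dF dl) -[d_y i F p]/(ell F i p).
by move: (F p) (ell F i p) (ell F j p) (d_y i _ p) => a b c d; field.
Qed.

Lemma euler_F p : U p -> p.2 0 0 * ell F 0 p + p.2 0 1 * ell F 1 p = F p.
Proof.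
move=> Up; rewrite (euler hF Up); first by rewrite mul1r.
exact: smooth_on_diff sF Up.
Qed.

Lemma homogeneous_ell j : homogeneous_on U 0 (ell F j).
Proof.
move=> p l Up l0; have l00 : l != 0 by rewrite gt_eqF.
have := d_y_dilate j oU hF (fun q => smooth_on_diff sF (p := q)) cU Up l0.
by rewrite expr1 mul1r => /(mulfI l00).
Qed.

Lemma euler_ell j p : U p ->
  p.2 0 0 * d_y 0 (ell F j) p + p.2 0 1 * d_y 1 (ell F j) p = 0.
Proof.
move=> Up; rewrite (euler (@homogeneous_ell j) Up); first by rewrite mul0r.
exact: smooth_on_diff (smooth_ell j) Up.
Qed.

Lemma homogeneous_gij i j : homogeneous_on U 0 (gij F i j).
Proof.
move=> p l Up l0; rewrite (gijE _ _ (cU Up l0)) (gijE _ _ Up).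
have := d_y_dilate i oU (@homogeneous_ell j)
  (fun q => smooth_on_diff (smooth_ell j) (p := q)) cU Up l0.
rewrite !(homogeneous_ell _ Up l0) (hF Up l0) expr1 expr0 !mul1r => <-.
by rewrite mulrCA mulrA.
Qed.

Lemma euler_gij i j p : U p ->
  p.2 0 0 * d_y 0 (gij F i j) p +
  p.2 0 1 * d_y 1 (gij F i j) p = 0.
Proof.
move=> Up; rewrite (euler (@homogeneous_gij i j) Up); first by rewrite mul0r.
exact: smooth_on_diff (smooth_gij i j) Up.
Qed.

Lemma homogeneous_cartan i j k : homogeneous_on U 0 (fun q => F q * cartan F i j k q).
Proof.
move=> p l Up l0; rewrite (hF Up l0) expr1 expr0 mul1r !cartan_gij.
have := d_y_dilate k oU (@homogeneous_gij i j)
  (fun q => smooth_on_diff (smooth_gij i j) (p := q)) cU Up l0.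
rewrite expr0 mul1r => <-.
by move: (F p) (d_y k _ _) => a b; ring.
Qed.

Lemma gij_y j p : U p ->
  p.2 0 0 * gij F 0 j p + p.2 0 1 * gij F 1 j p = F p * ell F j p.
Proof.
move=> Up; rewrite !(gijE _ _ Up).
have := euler_F Up; have := euler_ell j Up.
move: (p.2 0 0) (p.2 0 1) (ell F 0 p) (ell F 1 p) (ell F j p) (F p).
move: (d_y 0 _ p) (d_y 1 _ p) => d0 d1 y0 y1 l0 l1 l f e0 e1.
have -> : y0 * (l0 * l + f * d0) + y1 * (l1 * l + f * d1) =
  (y0 * l0 + y1 * l1) * l + f * (y0 * d0 + y1 * d1) by ring.
by rewrite e0 e1 mulr0 addr0.
Qed.

End Geometry.
End Chart.

(** * Modified Berwald frames *)

Lemma det_mx2 (R : comPzRingType) (a : 'M[R]_2) :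
  \det a = a 0 0 * a 1 1 - a 0 1 * a 1 0.
Proof.
rewrite (expand_det_row _ 0) big_ord_recl big_ord1 /cofactor !det_mx11 !mxE /=.
have -> : lift (0 : 'I_2) (0 : 'I_1) = 1 by exact: val_inj.
have -> : lift (1 : 'I_2) (0 : 'I_1) = 0 by exact: val_inj.
have -> : (ord0 : 'I_2) = 0 by exact: val_inj.
by rewrite expr0 expr1 mul1r mulN1r mulrN.
Qed.

Section Frame.
Variables (R : realType) (U : set (pt R)) (F eps : pt R -> R) (m : pt R -> 'rV[R]_2).
Hypothesis B : berwald_chart U F eps m.

Let oU := bc_open B.
Let cU := bc_conic B.
Let sF := bc_smooth B.
Let hF := bc_hom B.

Let nearU p : U p -> \forall q \near p, U q.
Proof. by move=> Up; exact: open_nbhs_nbhs. Qed.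

Lemma gij_frame i j p : U p ->
  gij F i j p = ell F i p * ell F j p + eps p * m p 0 i * m p 0 j.
Proof. by move=> Up; rewrite -metric_gij (bc_metric B). Qed.

Lemma eps_sqr p : U p -> eps p * eps p = 1.
Proof. by move=> Up; case: (bc_eps B Up) => ->; rewrite ?mulrNN mulr1. Qed.

Lemma eps_neq0 p : U p -> eps p != 0.
Proof. by move=> Up; case: (bc_eps B Up) => ->; rewrite ?oppr_eq0 oner_eq0. Qed.

(** [det g = eps (l_0 m_1 - l_1 m_0) ^ 2], so that [l] and [m] are independent. *)
Lemma wedge_neq0 p : U p -> ell F 0 p * m p 0 1 - ell F 1 p * m p 0 0 != 0.
Proof.
move=> Up; have := bc_unit B Up; rewrite unitmxE unitfE det_mx2 !metric_gij.
rewrite !(gij_frame _ _ Up); apply: contra_neq.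
move: (ell F 0 p) (ell F 1 p) (m p 0 0) (m p 0 1) (eps p) => a b c d e w0.
transitivity (e * (a * d - b * c) ^+ 2); first by ring.
by rewrite w0 expr0n mulr0.
Qed.

(** [y^i m_i = 0]: contract [g_ij = l_i l_j + eps m_i m_j] with [y^i]. *)
Lemma m_y p : U p -> p.2 0 0 * m p 0 0 + p.2 0 1 * m p 0 1 = 0.
Proof.
move=> Up; have := gij_y oU cU sF hF 0 Up; have := gij_y oU cU sF hF 1 Up.
have := euler_F sF hF Up; have := wedge_neq0 Up; have := eps_neq0 Up.
rewrite !(gij_frame _ _ Up).
move: (ell F 0 p) (ell F 1 p) (m p 0 0) (m p 0 1) (eps p) (p.2 0 0) (p.2 0 1) (F p).
move=> a b c d e x y f e0 w0 ef e1 e2; apply: (mulfI e0); apply: (mulfI w0).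
rewrite !mulr0.
transitivity (a * (x * (a * b + e * c * d) + y * (b * b + e * d * d) - f * b) -
  b * (x * (a * a + e * c * c) + y * (b * a + e * d * c) - f * a)).
  by rewrite -ef; ring.
by rewrite e1 e2 !subrr !mulr0 subrr.
Qed.

Lemma y_wedge0 p : U p ->
  p.2 0 0 * (ell F 0 p * m p 0 1 - ell F 1 p * m p 0 0) = F p * m p 0 1.
Proof.
move=> Up; rewrite -(euler_F sF hF Up); have := m_y Up.
move: (ell F 0 p) (ell F 1 p) (m p 0 0) (m p 0 1) (p.2 0 0) (p.2 0 1).
move=> a b c d x y h; apply/eqP; rewrite -subr_eq0; apply/eqP.
by transitivity (- b * (x * c + y * d)); [ring|rewrite h mulr0].
Qed.

Lemma y_wedge1 p : U p ->
  p.2 0 1 * (ell F 0 p * m p 0 1 - ell F 1 p * m p 0 0) = - (F p * m p 0 0).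
Proof.
move=> Up; rewrite -(euler_F sF hF Up); have := m_y Up.
move: (ell F 0 p) (ell F 1 p) (m p 0 0) (m p 0 1) (p.2 0 0) (p.2 0 1).
move=> a b c d x y h; apply/eqP; rewrite -subr_eq0; apply/eqP.
by transitivity (a * (x * c + y * d)); [ring|rewrite h mulr0].
Qed.

Lemma F_neq0 p : U p -> F p != 0.
Proof.
move=> Up; apply/eqP => F0; have := bc_slit B Up.
have := y_wedge0 Up; have := y_wedge1 Up; rewrite F0 !mul0r oppr0.
move=> /eqP; rewrite mulf_eq0 (negbTE (wedge_neq0 Up)) orbF => /eqP y1.
move=> /eqP; rewrite mulf_eq0 (negbTE (wedge_neq0 Up)) orbF => /eqP y0.
by rewrite (row2P p.2) y0 y1 !scale0r addr0 eqxx.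
Qed.

Lemma frame_independent (a b a' b' : R) p : U p ->
  (forall i, a * ell F i p + b * m p 0 i = a' * ell F i p + b' * m p 0 i) ->
  a = a' /\ b = b'.
Proof.
move=> Up h; have := h 0; have := h 1; have := wedge_neq0 Up.
move: (ell F 0 p) (ell F 1 p) (m p 0 0) (m p 0 1) => l0 l1 m0 m1 w h1 h0.
split; apply: (mulfI w).
  transitivity (m1 * (a * l0 + b * m0) - m0 * (a * l1 + b * m1)); first by ring.
  by rewrite h0 h1; ring.
transitivity (l0 * (a * l1 + b * m1) - l1 * (a * l0 + b * m0)); first by ring.
by rewrite h0 h1; ring.
Qed.

Lemma frame_componentsE (w : 'I_2 -> R) (a b : R) p : U p ->
  (forall i, w i = a * ell F i p + b * m p 0 i) ->
  frame_components F m w p = (a, b).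
Proof.
move=> Up h; apply: xget_unique => // -[a' b'] /= h'.
have [] // := @frame_independent a' b' a b p Up; last by move=> -> ->.
by move=> i; rewrite -h -h'.
Qed.

(** Since [y^i l_i = F] and [y^i m_i = 0], the [l]-component of a covector is
    read off from its contraction with [y]. *)
Lemma covector_decomp (w : 'I_2 -> R) (c : R) p : U p ->
  p.2 0 0 * w 0 + p.2 0 1 * w 1 = c * F p ->
  exists b, forall i, w i = c * ell F i p + b * m p 0 i.
Proof.
move=> Up hw.
exists ((ell F 0 p * w 1 - ell F 1 p * w 0) /
  (ell F 0 p * m p 0 1 - ell F 1 p * m p 0 0)) => i.
have := F_neq0 Up; have := wedge_neq0 Up; have := y_wedge0 Up; have := y_wedge1 Up.
have -> : w i = if i == 0 then w 0 else w 1 by case: (ord2P i) => ->.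
have -> : ell F i p = if i == 0 then ell F 0 p else ell F 1 p by case: (ord2P i) => ->.
have -> : m p 0 i = if i == 0 then m p 0 0 else m p 0 1 by case: (ord2P i) => ->.
move: hw; move: (ell F 0 p) (ell F 1 p) (m p 0 0) (m p 0 1) (p.2 0 0) (p.2 0 1).
move: (F p) (w 0) (w 1).
move=> f w0 w1 a b m0 m1 x y hw h1 h0 W f0.
have K : w0 * m1 - w1 * m0 = c * (a * m1 - b * m0).
  apply: (mulfI f0).
  transitivity ((x * w0 + y * w1) * (a * m1 - b * m0)); last by rewrite hw; ring.
  transitivity (w0 * (f * m1) + w1 * - (f * m0)); first by ring.
  by rewrite -h0 -h1; ring.
apply: (mulfI W); case: (i == 0).
  transitivity (c * (a * m1 - b * m0) * a + (a * w1 - b * w0) * m0).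
    by rewrite -K; ring.
  by field.
transitivity (c * (a * m1 - b * m0) * b + (a * w1 - b * w0) * m1).
  by rewrite -K; ring.
by field.
Qed.

End Frame.

(** * Structure equations and the main scalar *)

Section MainScalar.
Variables (R : realType) (U : set (pt R)) (F eps : pt R -> R) (m : pt R -> 'rV[R]_2).
Hypothesis B : berwald_chart U F eps m.

Let oU := bc_open B.
Let cU := bc_conic B.
Let sF := bc_smooth B.
Let hF := bc_hom B.

Let nearU p : U p -> \forall q \near p, U q.
Proof. by move=> Up; exact: open_nbhs_nbhs. Qed.

Lemma m_neq0 p : U p -> exists i, m p 0 i != 0.
Proof.
move=> Up; have := wedge_neq0 B Up.
have [-> h|h _] := eqVneq (m p 0 0) 0; last by exists 0.
exists 1; apply/eqP => m1; move/eqP: h; apply.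
by rewrite m1 !mulr0 subrr.
Qed.

(** [g_ii - l_i ^ 2] is continuous and has the sign of [eps] where [m_i] does
    not vanish. *)
Lemma eps_near p : U p -> \forall q \near p, eps q = eps p.
Proof.
move=> Up; have [i mi] := m_neq0 Up.
pose f q := eps p * (gij F i i q - ell F i q * ell F i q).
have fE q : U q -> f q = (eps p * eps q) * m q 0 i ^+ 2.
  by move=> Uq; rewrite /f (gij_frame B i i Uq); ring.
have df : differentiable f p.
  have dg := smooth_on_diff (smooth_gij oU sF i i) Up.
  have dl := smooth_on_diff (smooth_ell sF i) Up.
  apply: differentiable_mul; first exact: differentiable_cst.
  by apply: differentiableB => //; exact: differentiable_mul.
have f0 : 0 < f p by rewrite fE// (eps_sqr B Up) mul1r exprn_even_gt0.
near=> q; have Uq : U q by near: q; exact: nearU.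
have : 0 < f q by near: q; exact: (near_gt0 df f0).
rewrite fE//; case: (bc_eps B Up) => ->; case: (bc_eps B Uq) => -> //.
  by rewrite mul1r mulN1r oppr_gt0 ltNge sqr_ge0.
by rewrite mulr1 mulN1r oppr_gt0 ltNge sqr_ge0.
Unshelve. all: by end_near. Qed.

Lemma F_d_y_ell k i p : U p ->
  F p * d_y k (ell F i) p = eps p * m p 0 k * m p 0 i.
Proof.
move=> Up; have := gij_frame B k i Up; rewrite (gijE oU sF k i Up).
exact: addrI.
Qed.

Lemma F_d_y_gij i j k p : U p -> F p * d_y k (gij F i j) p =
  (eps p * m p 0 k * m p 0 i) * ell F j p + ell F i p * (eps p * m p 0 k * m p 0 j) +
  eps p * ((F p * d_y k (fun q => m q 0 i) p) * m p 0 j +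
           m p 0 i * (F p * d_y k (fun q => m q 0 j) p)).
Proof.
move=> Up.
have dl a := smooth_on_diff (smooth_ell sF a) Up.
have dm a := bc_m B a Up.
rewrite (@d_y_near _ _ _ (fun q => ell F i q * ell F j q +
  eps p * (m q 0 i * m q 0 j))); last first.
  near=> q; have Uq : U q by near: q; exact: nearU.
  rewrite (gij_frame B i j Uq) mulrA; congr (_ + _ * _ * _).
  by near: q; exact: eps_near.
have dmm : differentiable (fun q => m q 0 i * m q 0 j) p by exact: differentiable_mul.
have demm : differentiable (fun q => eps p * (m q 0 i * m q 0 j)) p.
  by apply: differentiable_mul => //; exact: differentiable_cst.
have dll : differentiable (fun q => ell F i q * ell F j q) p by exact: differentiable_mul.
rewrite (d_yD k dll demm) (d_yZ k (eps p) dmm) (d_yM k (dm i) (dm j)).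
rewrite (d_yM k (dl i) (dl j)) -!(F_d_y_ell _ _ Up).
move: (d_y k (ell F i) p) (d_y k (ell F j) p) (d_y k (fun q => m q 0 i) p).
move: (d_y k (fun q => m q 0 j) p) (F p).
by move: (ell F i p) (ell F j p) (m p 0 i) (m p 0 j) (eps p) => *; ring.
Unshelve. all: by end_near. Qed.

(** Differentiating [y^i m_i = 0]. *)
Lemma y_d_y_m k p : U p ->
  p.2 0 0 * d_y k (fun q => m q 0 0) p + p.2 0 1 * d_y k (fun q => m q 0 1) p
  = - m p 0 k.
Proof.
move=> Up; have dm a := bc_m B a Up; have dy a := differentiable_y a p.
have d0 : differentiable (fun q : pt R => q.2 0 0 * m q 0 0) p.
  exact: differentiable_mul.
have d1 : differentiable (fun q : pt R => q.2 0 1 * m q 0 1) p.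
  exact: differentiable_mul.
have : d_y k (fun q : pt R => q.2 0 0 * m q 0 0 + q.2 0 1 * m q 0 1) p = 0.
  rewrite (@d_y_near _ _ _ (fun=> 0)); first exact: (derive_cst (0 : R) p _).
  by apply: filterS (nearU Up) => q; exact: m_y B q.
rewrite (d_yD k d0 d1) (d_yM k (dy 0) (dm 0)) (d_yM k (dy 1) (dm 1)) !d_y_y.
move: (d_y k _ p) (d_y k _ p) => a b.
by case: (ord2P k) => -> /=; rewrite mulr0 mulr1 => h; apply/eqP;
  rewrite -subr_eq0 opprK -h; apply/eqP; ring.
Qed.

(** The vertical derivative of [m], up to the coefficient [b] which turns out to
    be [eps] times the main scalar. *)
Lemma F_d_y_m_ex p : U p -> exists b : R, forall k i,
  F p * d_y k (fun q => m q 0 i) p = b * m p 0 k * m p 0 i - m p 0 k * ell F i p.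
Proof.
move=> Up.
have H k : exists b, forall i, F p * d_y k (fun q => m q 0 i) p =
    - m p 0 k * ell F i p + b * m p 0 i.
  apply: (covector_decomp B Up); have := y_d_y_m k Up.
  move: (F p) (m p 0 k) (d_y k _ p) (d_y k _ p) => f a b c <-; ring.
have [b0 h0] := H 0; have [b1 h1] := H 1.
pose b_ k : R := if k == 0 :> 'I_2 then b0 else b1.
have h k i : F p * d_y k (fun q => m q 0 i) p = - m p 0 k * ell F i p + b_ k * m p 0 i.
  by case: (ord2P k) => ->; rewrite /b_ /=.
have [j mj] := m_neq0 Up.
have yb : p.2 0 0 * b_ 0 + p.2 0 1 * b_ 1 = 0 * F p.
  have := euler_gij oU cU sF hF j j Up; have := m_y B Up; have eps0 := eps_neq0 B Up.
  have G k : F p * d_y k (gij F j j) p = 2 * eps p * m p 0 j ^+ 2 * b_ k.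
    by rewrite F_d_y_gij// h; ring.
  have := G 0; have := G 1.
  move: (d_y 0 _ p) (d_y 1 _ p) => c d G1 G0 _ E; rewrite mul0r.
  have N0 : 2 * eps p * m p 0 j ^+ 2 != 0.
    by rewrite !mulf_neq0 ?expf_neq0// pnatr_eq0.
  apply: (mulfI N0); rewrite mulr0 -[RHS](mulr0 (F p)) -E.
  transitivity (p.2 0 0 * (2 * eps p * m p 0 j ^+ 2 * b_ 0) +
    p.2 0 1 * (2 * eps p * m p 0 j ^+ 2 * b_ 1)); first by ring.
  by rewrite -G0 -G1; ring.
have [b hb] := covector_decomp B Up yb.
exists b => k i; rewrite h hb.
by move: (m p 0 k) (m p 0 i) (ell F i p) => *; ring.
Qed.

Lemma main_scalar_ex p : U p -> exists t : R,
  (forall i j k, F p * cartan F i j k p = t * m p 0 i * m p 0 j * m p 0 k) /\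
  (forall k i, F p * d_y k (fun q => m q 0 i) p =
     eps p * t * m p 0 k * m p 0 i - m p 0 k * ell F i p).
Proof.
move=> Up; have [b hb] := F_d_y_m_ex Up; exists (eps p * b); split=> [i j k|k i].
  rewrite cartan_gij mulrCA F_d_y_gij// !hb.
  by move: (ell F i p) (ell F j p) (m p 0 i) (m p 0 j) (m p 0 k) (eps p) => *; field.
by rewrite hb mulrA (eps_sqr B Up) mul1r.
Qed.

(** The defining property of the main scalar, whose value is a default one where
    no such scalar exists. *)
Lemma main_scalarP p i j k : U p ->
  F p * cartan F i j k p = main_scalar F m p * m p 0 i * m p 0 j * m p 0 k.
Proof.
move=> Up; have [t [ht _]] := main_scalar_ex Up.
rewrite /main_scalar.
case: xgetP => [t' _ /=|/(_ t)]; [exact|by []].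
Qed.

Lemma main_scalar_uniq p t : U p ->
  (forall i j k, F p * cartan F i j k p = t * m p 0 i * m p 0 j * m p 0 k) ->
  main_scalar F m p = t.
Proof.
move=> Up ht; have [i mi] := m_neq0 Up; have := ht i i i.
rewrite main_scalarP// => e.
by do 3 apply: (mulIf mi).
Qed.

Lemma F_d_y_m k i p : U p -> F p * d_y k (fun q => m q 0 i) p =
  eps p * main_scalar F m p * m p 0 k * m p 0 i - m p 0 k * ell F i p.
Proof.
by move=> Up; have [t [ht hm]] := main_scalar_ex Up; rewrite (main_scalar_uniq Up ht).
Qed.

Lemma differentiable_main_scalar p : U p -> differentiable (main_scalar F m) p.
Proof.
move=> Up; have [i mi] := m_neq0 Up.
pose m3 q := m q 0 i * m q 0 i * m q 0 i.
have dm := bc_m B i Up.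
have dm3 : differentiable m3 p by do 2 apply: differentiable_mul => //.
have m30 q : m q 0 i != 0 -> m3 q != 0 by move=> h; rewrite !mulf_neq0.
apply: (@differentiable_near_eq _ _ (fun q => (F q * cartan F i i i q) * (m3 q)^-1)).
  near=> q; have Uq : U q by near: q; exact: nearU.
  have mq : m q 0 i != 0 by near: q; exact: (near_neq0 dm mi).
  have -> : F q * cartan F i i i q = main_scalar F m q * m3 q.
    by rewrite main_scalarP// /m3 !mulrA.
  by rewrite mulfK//; exact: m30.
apply: differentiable_mul.
  by apply: differentiable_mul;
    [exact: smooth_on_diff sF Up|exact: smooth_on_diff (smooth_cartan oU sF i i i) Up].
exact: differentiableV (m30 _ mi).
Unshelve. all: by end_near. Qed.

(** The frame covector is infinitesimally homogeneous of degree 0. *)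
Lemma euler_m i p : U p ->
  p.2 0 0 * d_y 0 (fun q => m q 0 i) p + p.2 0 1 * d_y 1 (fun q => m q 0 i) p = 0.
Proof.
move=> Up.
apply: (mulfI (F_neq0 B Up)); have := m_y B Up.
have := F_d_y_m 0 i Up; have := F_d_y_m 1 i Up.
move: (F p) (d_y 0 _ p) (d_y 1 _ p) => f a b h1 h0 h; rewrite mulr0.
transitivity (p.2 0 0 * (f * a) + p.2 0 1 * (f * b)); first by ring.
rewrite h0 h1.
transitivity ((p.2 0 0 * m p 0 0 + p.2 0 1 * m p 0 1) *
  (eps p * main_scalar F m p * m p 0 i - ell F i p)); first by ring.
by rewrite h mul0r.
Qed.

Lemma euler_main_scalar p : U p ->
  p.2 0 0 * d_y 0 (main_scalar F m) p + p.2 0 1 * d_y 1 (main_scalar F m) p = 0.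
Proof.
move=> Up; have [i mi] := m_neq0 Up.
have dm := bc_m B i Up; have dI := differentiable_main_scalar Up.
pose m3 q := m q 0 i * (m q 0 i * m q 0 i).
have dm2 : differentiable (fun q => m q 0 i * m q 0 i) p by exact: differentiable_mul.
have dm3 : differentiable m3 p by exact: differentiable_mul.
have dC : differentiable (fun q => F q * cartan F i i i q) p.
  by apply: differentiable_mul;
    [exact: smooth_on_diff sF Up|exact: smooth_on_diff (smooth_cartan oU sF i i i) Up].
have := euler (homogeneous_cartan oU cU sF hF i i i) Up dC; rewrite mul0r.
have E k : d_y k (fun q => F q * cartan F i i i q) p =
   d_y k (fun q => main_scalar F m q * m3 q) p.
  apply: d_y_near; near=> q; have Uq : U q by near: q; exact: nearU.
  by rewrite main_scalarP// /m3 !mulrA.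
rewrite !E !(d_yM _ dI dm3) !(d_yM _ dm dm2) !(d_yM _ dm dm).
have ym := euler_m i Up.
rewrite /m3; move: ym mi.
move: (d_y 0 (main_scalar F m) p) (d_y 1 (main_scalar F m) p) (main_scalar F m p).
move: (d_y 0 _ p) (d_y 1 _ p) (p.2 0 0) (p.2 0 1) (m p 0 i).
move=> a b x y c c0 d e ym mi h.
have c3 : c * (c * c) != 0 by rewrite !mulf_neq0.
apply: (mulfI c3); rewrite mulr0 -[RHS]h.
transitivity (c * (c * c) * (x * c0 + y * d) + 3 * e * c * c * (x * a + y * b)).
  by rewrite ym mulr0 addr0.
by ring.
Unshelve. all: by end_near. Qed.

End MainScalar.

(** * Landsberg metrics with a fibrewise constant main scalar *)

Section Rigidity.
Variables (R : realType) (U : set (pt R)) (F eps : pt R -> R) (m : pt R -> 'rV[R]_2).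
Hypothesis B : berwald_chart U F eps m.

Let oU := bc_open B.

(** If [f_{;1} = 0], then [F d_i f = f_{;2} m_i]. *)
Lemma vder2P (f : pt R -> R) p i : U p ->
  p.2 0 0 * d_y 0 f p + p.2 0 1 * d_y 1 f p = 0 ->
  F p * d_y i f p = vder2 F m f p * m p 0 i.
Proof.
move=> Up yf; have [||b hb] :=
  @covector_decomp _ _ _ _ _ B (fun i => F p * d_y i f p) 0 p.
- exact: Up.
- rewrite /= mul0r; apply: etrans (mulr0 (F p)); rewrite -yf.
  by move: (d_y 0 f p) (d_y 1 f p) (F p) => *; ring.
rewrite /vder2 (frame_componentsE B Up hb) /=.
by rewrite hb mul0r add0r.
Qed.

(** [m_i m^i = eps], as [eps ^ 2 = 1]. *)
Lemma m_m_up p : U p ->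
  eps p * (m p 0 0 * m_up F m 0 p + m p 0 1 * m_up F m 1 p) = 1.
Proof.
move=> Up; pose v := invmx (metric F p) *m (m p)^T.
have vE i : m_up F m i p = v i 0.
  by rewrite /v mxE; apply: eq_bigr => j _; rewrite !mxE.
have gv j : gij F j 0 p * v 0 0 + gij F j 1 p * v 1 0 = m p 0 j.
  have : (metric F p *m v) j 0 = m p 0 j by rewrite /v mulKVmx ?(bc_unit B)// mxE.
  by rewrite mxE sum2 !metric_gij.
rewrite !vE.
have [] // := @frame_independent _ _ _ _ _ B
  (ell F 0 p * v 0 0 + ell F 1 p * v 1 0)
  (eps p * (m p 0 0 * v 0 0 + m p 0 1 * v 1 0)) 0 1 p Up.
move=> j; rewrite mul0r add0r mul1r -[RHS]gv !(gij_frame B j _ Up).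
move: (ell F 0 p) (ell F 1 p) (ell F j p) (v 0 0) (v 1 0) (eps p) (m p 0 j).
by move: (m p 0 0) (m p 0 1) => *; ring.
Qed.

(** The vertical condition forces [I_{;2} = 0], hence all vertical derivatives of
    the main scalar vanish. *)
Lemma d_y_main_scalar_eq0 (phi : pt R -> R) p i : U p ->
  (exists2 c, c != 0 & forall i, d_y i phi p = c * m p 0 i) ->
  (forall j k r : 'I_2,
     \sum_i d_y i phi p * T_tensor F m i j k r p = 0) ->
  d_y i (main_scalar F m) p = 0.
Proof.
move=> Up [c c0 hc] T0; have F0 := F_neq0 B Up.
suff I2 : vder2 F m (main_scalar F m) p = 0.
  by apply: (mulfI F0); rewrite (vder2P i Up (euler_main_scalar B Up)) I2 mul0r mulr0.
have [j mj] := m_neq0 B Up; have := T0 j j j.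
rewrite sum2 /T_tensor !hc => h.
have N0 : c * (F p)^-1 * (m p 0 j * m p 0 j * m p 0 j) != 0.
  by rewrite !mulf_neq0 ?invr_neq0.
apply: (mulfI N0); rewrite mulr0 -[RHS](mulr0 (eps p)) -h.
rewrite -[LHS]mulr1 -(m_m_up Up).
move: (vder2 _ _ _ _) (m_up F m 0 p) (m_up F m 1 p) (F p)^-1 (eps p) (m p 0 j).
by move: (m p 0 0) (m p 0 1) => *; ring.
Qed.

(** If the main scalar is locally constant on the fibres, then
    [delta_i I = d_i I] does not depend on [y] locally, so that the Landsberg
    equation [y^i d_i I = 0] can be differentiated in [y] and gives
    [d_j I = 0]. *)
Lemma d_x_main_scalar_eq0 p j :
  (forall q i, U q -> d_y i (main_scalar F m) q = 0) ->
  (forall q, U q -> hder1 F m (main_scalar F m) q = 0) -> U p ->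
  d_x j (main_scalar F m) p = 0.
Proof.
move=> I0 L Up; set I := main_scalar F m in I0 L *.
have dI q : U q -> differentiable I q by exact: (differentiable_main_scalar B).
have deltaE q i : U q -> delta F i I q = d_x i I q.
  by move=> Uq; rewrite /delta sum2 !I0// !mulr0 addr0 subr0.
have yI q : U q -> q.2 0 0 * d_x 0 I q + q.2 0 1 * d_x 1 I q = 0.
  move=> Uq; have F0 := F_neq0 B Uq.
  pose c := (q.2 0 0 * delta F 0 I q + q.2 0 1 * delta F 1 I q) / F q.
  have [|b hb] := @covector_decomp _ _ _ _ _ B (fun i => delta F i I q) c q Uq.
    by rewrite /c divfK.
  have := L q Uq; rewrite /hder1 (frame_componentsE B Uq hb) /= /c => /eqP.
  by rewrite mulf_eq0 invr_eq0 (negbTE F0) orbF !deltaE// => /eqP.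
have cst i : \forall s \near (0 : R),
    d_x i I (s *: ((0, delta_mx 0 j) : pt R) + p) = d_x i I p.
  by apply: (derive_cst_along _ oU dI _ Up) => q; exact: I0.
have Us : \forall s \near (0 : R), U (s *: ((0, delta_mx 0 j) : pt R) + p).
  have [d d0 dU] := near_plane 0 (((0, delta_mx 0 j) : pt R)) oU Up.
  near=> s; have sd : `|s| < d by near: s; exact: (@nbhs0_lt _ R^o).
  have z0 : `|0 : R| < d by rewrite normr0.
  by have := dU 0 s z0 sd; rewrite scaler0 add0r.
have near_s := filterI (filterI Us (cst 0)) (cst 1).
have [e /= e0 eP] := (nbhs_ballP _ _).1 (near_s _ _).
pose s := e / 2; have s0 : s != 0 by rewrite gt_eqF// divr_gt0.
have es : ball (0 : R) e s.
  rewrite -ball_normE /= sub0r normrN gtr0_norm ?divr_gt0//.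
  by rewrite ltr_pdivrMr// ltr_pMr// ltr1n.
have [[U1 c0] c1] := eP s es.
  have yE k : (s *: ((0, delta_mx 0 j) : pt R) + p).2 0 k = s * (k == j)%:R + p.2 0 k.
    by rewrite !mxE.
  have : (s * (0 == j)%:R + p.2 0 0) * d_x 0 I p +
      (s * (1 == j)%:R + p.2 0 1) * d_x 1 I p = 0.
    have subst (a b c d b' d' : R) :
      a * b + c * d = 0 -> b = b' -> d = d' -> a * b' + c * d' = 0.
      by move=> h <- <-.
    by have := subst _ _ _ _ _ _ (yI _ U1) c0 c1; rewrite (yE 0) (yE 1).
  have y0 := yI _ Up => ys; apply: (mulfI s0); move: y0 ys.
  case: (ord2P j) => ->.
    move: (d_x 0 I p) (d_x 1 I p) => a b e1 /=.
    by rewrite mulr1 mulr0 add0r mulrDl -addrA e1 addr0.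
  move: (d_x 0 I p) (d_x 1 I p) => a b e1 /=.
  by rewrite mulr1 mulr0 add0r mulrDl addrCA e1 addr0.
Unshelve. all: by end_near. Qed.

Lemma berwald_of_landsberg (phi : pt R -> R) :
  (forall p, U p -> exists2 c, c != 0 & forall i, d_y i phi p = c * m p 0 i) ->
  (forall p, U p -> forall j k r : 'I_2,
     \sum_i d_y i phi p * T_tensor F m i j k r p = 0) ->
  (forall p, U p -> hder1 F m (main_scalar F m) p = 0) ->
  forall p, U p -> hder2 F m (main_scalar F m) p = 0.
Proof.
move=> hphi T0 L p Up.
have I0 q i : U q -> d_y i (main_scalar F m) q = 0.
  by move=> Uq; exact: d_y_main_scalar_eq0 (hphi q Uq) (T0 q Uq).
rewrite /hder2 (@frame_componentsE _ _ _ _ _ B _ 0 0 p Up)// => i.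
rewrite !mul0r addr0 /delta sum2 !I0// !mulr0 addr0 subr0.
exact: d_x_main_scalar_eq0.
Qed.

End Rigidity.

(** * Anisotropic conformal changes *)

Section Conformal.
Variables (R : realType) (U : set (pt R)) (F eps : pt R -> R) (m : pt R -> 'rV[R]_2).
Variable phi : pt R -> R.
Hypothesis B : berwald_chart U F eps m.
Hypotheses (sphi : smooth_on U phi) (hphi : homogeneous_on U 0 phi).

Let oU := bc_open B.
Let cU := bc_conic B.
Let sF := bc_smooth B.
Let hF := bc_hom B.

Let nearU p : U p -> \forall q \near p, U q.
Proof. by move=> Up; exact: open_nbhs_nbhs. Qed.

Local Notation phi2 := (vder2 F m phi).

(** [phi_{;1} = 0] because [phi] is homogeneous of degree 0. *)
Lemma F_d_y_phi p i : U p -> F p * d_y i phi p = phi2 p * m p 0 i.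
Proof.
move=> Up; apply: (vder2P B i Up); rewrite (euler hphi Up) ?mul0r//.
exact: smooth_on_diff sphi Up.
Qed.

Let dF_d_y_phi i p : U p -> differentiable (fun q => F q * d_y i phi q) p.
Proof.
move=> Up; apply: differentiable_mul; first exact: smooth_on_diff sF Up.
by apply: (smooth_on_diff _ Up); exact: smooth_on_derive.
Qed.

Lemma differentiable_phi2 p : U p -> differentiable phi2 p.
Proof.
move=> Up; have [i mi] := m_neq0 B Up; have dm := bc_m B i Up.
apply: (@differentiable_near_eq _ _ (fun q => (F q * d_y i phi q) * (m q 0 i)^-1)).
  near=> q; have Uq : U q by near: q; exact: nearU.
  have mq : m q 0 i != 0 by near: q; exact: (near_neq0 dm mi).
  by rewrite F_d_y_phi// mulfK.
apply: differentiable_mul; first exact: dF_d_y_phi.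
exact: differentiableV.
Unshelve. all: by end_near. Qed.

Lemma euler_phi2 p : U p -> p.2 0 0 * d_y 0 phi2 p + p.2 0 1 * d_y 1 phi2 p = 0.
Proof.
move=> Up; have [i mi] := m_neq0 B Up; have dm := bc_m B i Up.
have d2 := differentiable_phi2 Up.
have h0 : homogeneous_on U 0 (fun q => F q * d_y i phi q).
  move=> q l Uq l0; rewrite (hF Uq l0) expr1 expr0 mul1r.
  have := d_y_dilate i oU hphi (fun q => smooth_on_diff sphi (p := q)) cU Uq l0.
  by rewrite expr0 mul1r => <-; rewrite mulrCA mulrA.
have := euler h0 Up (dF_d_y_phi i Up); rewrite mul0r.
have E k : d_y k (fun q => F q * d_y i phi q) p = d_y k (fun q => phi2 q * m q 0 i) p.
  by apply: d_y_near; apply: filterS (nearU Up) => q; exact: F_d_y_phi.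
rewrite (E 0) (E 1) !(d_yM _ d2 dm); have := euler_m B i Up.
move: mi; move: (d_y 0 (fun q => m q 0 i) p) (d_y 1 (fun q => m q 0 i) p).
move: (d_y 0 phi2 p) (d_y 1 phi2 p) (p.2 0 0) (p.2 0 1) (m p 0 i) (phi2 p).
move=> a b x y c d e f c0 ym h; apply: (mulfI c0); rewrite mulr0 -[RHS]h.
transitivity (c * (x * a + y * b) + d * (x * e + y * f)); last by ring.
by rewrite ym mulr0 addr0.
Qed.

Lemma F_d_y_phi2 i p : U p -> F p * d_y i phi2 p = vder2 F m phi2 p * m p 0 i.
Proof. by move=> Up; exact: (vder2P B i Up (euler_phi2 Up)). Qed.

Local Notation Fb := (fun q => expR (phi q) * F q).

Lemma smooth_conformal : smooth_on U Fb.
Proof. by apply: smooth_onM => //; exact: smooth_on_expR. Qed.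

Lemma homogeneous_conformal : homogeneous_on U 1 Fb.
Proof.
by move=> q l Uq l0; rewrite (hF Uq l0) (hphi Uq l0) expr0 mul1r mulrCA.
Qed.

Lemma ell_conformal i p : U p ->
  ell Fb i p = expR (phi p) * (ell F i p + phi2 p * m p 0 i).
Proof.
move=> Up; have dphi := smooth_on_diff sphi Up.
rewrite -(F_d_y_phi i Up) [LHS](d_yM i (differentiable_expR dphi) (smooth_on_diff sF Up)).
rewrite [d_y i (fun q => expR (phi q)) p](derive_expR_comp _ dphi).
rewrite -[d_y i F p]/(ell F i p) -[X in F p * (_ * X)]/(d_y i phi p).
move: (F p) (expR (phi p)) (ell F i p) (d_y i phi p) => *; ring.
Qed.

Local Notation N q := (sigma F eps m phi q + eps q - phi2 q ^+ 2).

(** The metric of [exp(phi) F]: apart from the product of its own covectors [l],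
    it is a multiple of [m_i m_j], the coefficient being [exp(2 phi) / rho]. *)
Lemma gij_conformal i j p : U p -> gij Fb i j p =
  ell Fb i p * ell Fb j p + expR (phi p) ^+ 2 * N p * m p 0 i * m p 0 j.
Proof.
move=> Up; rewrite (gijE oU smooth_conformal i j Up); congr (_ + _).
have dphi := smooth_on_diff sphi Up; have dE := differentiable_expR dphi.
have dl := smooth_on_diff (smooth_ell sF j) Up; have dm := bc_m B j Up.
have d2 := differentiable_phi2 Up.
have d2m : differentiable (fun q => phi2 q * m q 0 j) p by exact: differentiable_mul.
have ds : differentiable (fun q => ell F j q + phi2 q * m q 0 j) p.
  exact: differentiableD.
rewrite (@d_y_near _ i _ (fun q => expR (phi q) * (ell F j q + phi2 q * m q 0 j)));
  last by apply: filterS (nearU Up) => q; exact: ell_conformal.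
rewrite (d_yM i dE ds) (d_yD i dl d2m) (d_yM i d2 dm).
rewrite [d_y i (fun q => expR (phi q)) p](derive_expR_comp _ dphi).
rewrite -[X in _ + _ * (_ * X)]/(d_y i phi p) /sigma.
have := F_d_y_ell B i j Up; have := F_d_y_phi i Up; have := F_d_y_phi2 i Up.
have := F_d_y_m B i j Up.
move: (vder2 F m phi2 p) (phi2 p) (main_scalar F m p) (d_y i (ell F j) p).
move: (d_y i phi p) (d_y i phi2 p) (d_y i (fun q => m q 0 j) p) (expR (phi p)).
move: (ell F j p) (F p) (m p 0 i) (m p 0 j) (eps p).
move=> l f mi mj e dphi_i dphi2 dmj E phi22 phi2p I dlj hm h2 h1 hl.
transitivity (E ^+ 2 * (f * dlj + phi2p * (f * dmj) + mj * (f * dphi2) +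
  (l + phi2p * mj) * (f * dphi_i))); first by ring.
by rewrite hm h2 h1 hl; ring.
Qed.

Hypothesis N_neq0 : forall p, U p -> N p != 0.

Lemma eps_bar_rho p : U p -> 0 < eps_bar F eps m phi p / rho F eps m phi p.
Proof.
move=> Up; rewrite /eps_bar /rho invrK.
case: ifPn => //; rewrite -leNgt le_eqVlt mulf_eq0.
by rewrite (negbTE (eps_neq0 B Up)) (negbTE (N_neq0 Up)) /= mulNr oppr_gt0.
Qed.

Lemma eps_bar_cases p : U p -> eps_bar F eps m phi p = 1 \/ eps_bar F eps m phi p = -1.
Proof.
move=> Up; rewrite /eps_bar; case: (bc_eps B Up) => ->; case: ifP => _;
  by [left|right|left; rewrite opprK].
Qed.

(** The factor [kappa] with [m_bar = kappa m]. Its differentiability is not read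
    off from [sigma] but from the metric of [exp(phi) F]: up to sign,
    [kappa ^ 2 = (g_ii - l_i ^ 2) / m_i ^ 2] with [g] and [l] those of
    [exp(phi) F]. *)
Definition kappa p : R :=
  expR (phi p) * Num.sqrt (eps_bar F eps m phi p / rho F eps m phi p).

Lemma m_barE p i : m_bar F eps m phi p 0 i = kappa p * m p 0 i.
Proof. by rewrite mxE. Qed.

Lemma kappa_gt0 p : U p -> 0 < kappa p.
Proof. by move=> Up; rewrite mulr_gt0 ?expR_gt0// sqrtr_gt0; exact: eps_bar_rho. Qed.

Lemma kappa_sqr p : U p ->
  eps_bar F eps m phi p * kappa p ^+ 2 = expR (phi p) ^+ 2 * N p.
Proof.
move=> Up; rewrite exprMn sqr_sqrtr; last exact/ltW/eps_bar_rho.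
rewrite /rho invrK mulrCA; congr (_ * _); rewrite mulrA.
by case: (eps_bar_cases Up) => ->; rewrite ?mulrNN !mul1r.
Qed.

Lemma differentiable_kappa p : U p -> differentiable kappa p.
Proof.
move=> Up; have dphi := smooth_on_diff sphi Up; have dE := differentiable_expR dphi.
have [i mi] := m_neq0 B Up; have dm := bc_m B i Up.
have sFb := smooth_conformal.
(* [K q = kappa q ^ 2] where [eps_bar q = eps_bar p], and [- kappa q ^ 2]
   elsewhere; as [K] is continuous and [K p > 0], the former holds near [p]. *)
pose s := eps_bar F eps m phi p.
pose K q := s * (gij Fb i i q - ell Fb i q * ell Fb i q) * (m q 0 i * m q 0 i)^-1.
have KE q : U q -> m q 0 i != 0 -> K q = s * eps_bar F eps m phi q * kappa q ^+ 2.
  move=> Uq mq; rewrite -mulrA kappa_sqr// /K gij_conformal//.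
  by rewrite addrC addKr -mulrA -[_ * m q 0 i * m q 0 i]mulrA mulfK// mulf_neq0.
have dK : differentiable K p.
  apply: differentiable_mul.
    apply: differentiable_mul; first exact: differentiable_cst.
    apply: differentiableB; first exact: smooth_on_diff (smooth_gij oU sFb i i) Up.
    by apply: differentiable_mul; exact: smooth_on_diff (smooth_ell sFb i) Up.
  by apply: differentiableV; [exact: differentiable_mul|rewrite mulf_neq0].
have ss : s * s = 1 by rewrite /s; case: (eps_bar_cases Up) => ->; rewrite ?mulrNN mulr1.
have Kp : 0 < K p by rewrite KE// ss mul1r exprn_gt0// kappa_gt0.
apply: (@differentiable_near_eq _ _ (fun q => Num.sqrt (K q))).
  near=> q; have Uq : U q by near: q; exact: nearU.
  have mq : m q 0 i != 0 by near: q; exact: (near_neq0 dm mi).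
  have Kq : 0 < K q by near: q; exact: (near_gt0 dK Kp).
  have k2 : 0 < kappa q ^+ 2 by rewrite exprn_gt0// kappa_gt0.
  have -> : K q = kappa q ^+ 2.
    move: Kq; rewrite KE// pmulr_lgt0//.
    rewrite /s; case: (eps_bar_cases Up) => ->; case: (eps_bar_cases Uq) => ->.
    - by rewrite !mul1r.
    - by rewrite mul1r ltr0N1.
    - by rewrite mulr1 ltr0N1.
    - by rewrite mulrNN !mul1r.
  by rewrite sqrtr_sqr gtr0_norm// kappa_gt0.
apply: (differentiable_comp (f := K) (g := @Num.sqrt R)) => //.
apply/derivable1_diffP; have := is_derive1_sqrt Kp; exact: @ex_derive.
Unshelve. all: by end_near. Qed.

(** An anisotropic conformal change yields a pseudo-Finsler metric for which
    [m_bar] is a modified Berwald frame. *)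
Lemma berwald_chart_conformal :
  berwald_chart U Fb (eps_bar F eps m phi) (m_bar F eps m phi).
Proof.
have gE p i j : U p -> gij Fb i j p = ell Fb i p * ell Fb j p +
    eps_bar F eps m phi p * m_bar F eps m phi p 0 i * m_bar F eps m phi p 0 j.
  move=> Up; rewrite gij_conformal// !m_barE -(kappa_sqr Up).
  by congr (_ + _); move: (eps_bar _ _ _ _ _) (kappa p) (m p 0 i) (m p 0 j) => *; ring.
split=> //.
- exact: bc_slit B.
- exact: smooth_conformal.
- exact: homogeneous_conformal.
- move=> p i Up; rewrite (_ : (fun q => _) = fun q => kappa q * m q 0 i); last first.
    by apply/funext => q; rewrite m_barE.
  by apply: differentiable_mul; [exact: differentiable_kappa|exact: (bc_m B i Up)].
- move=> p Up; rewrite unitmxE unitfE det_mx2 !metric_gij !(gij_conformal _ _ Up).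
  rewrite !(ell_conformal _ Up).
  have E0 : expR (phi p) != 0 by rewrite gt_eqF// expR_gt0.
  have := wedge_neq0 B Up; have := N_neq0 Up.
  move: (N p) => n n0.
  move: (phi2 p) (expR (phi p)) E0 (ell F 0 p) (ell F 1 p) (m p 0 0) (m p 0 1).
  move=> f E E0 a b c d w0.
  rewrite [X in X != 0](_ : _ = E ^+ 2 * E ^+ 2 * n * (a * d - b * c) ^+ 2); last by ring.
  by rewrite !mulf_neq0 ?expf_neq0.
- exact: eps_bar_cases.
- by move=> p i j Up; rewrite metric_gij gE.
Qed.

End Conformal.

(** * From a surface to its charts *)

Section Surface.
Variables (R : realType) (M : topologicalType) (S : smooth_surface R M).
Variable A : set (tangent R M).

Lemma tangent_of_dilate (c : chart S) l q :
  tangent_of c (dilate l q) = ((tangent_of c q).1, l *: (tangent_of c q).2).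
Proof. by rewrite /tangent_of /= linearZ. Qed.

Lemma homogeneous_in_chart (c : chart S) r f : homogeneous A r f ->
  homogeneous_on (set_in_chart c A) r (in_chart c f).
Proof.
by move=> hf q l [_ Aq] l0; rewrite /in_chart /= tangent_of_dilate hf.
Qed.

Lemma berwald_chart_in_chart F eps m (c : chart S) :
  conic_subbundle S A -> conic_pseudo_finsler S A F -> berwald_frame A F eps m ->
  berwald_chart (set_in_chart c A) (in_chart c F) (eps c) (m c).
Proof.
move=> [_ oA nzA conA _] [sF hF uF] /(_ c) [sm frame]; split.
- exact: oA.
- move=> q l [dq Aq] l0; split=> //; rewrite tangent_of_dilate; exact: conA.
- move=> q [_ /nzA]; apply: contra_neq => ->; exact: linear0.
- exact: sF.
- exact: homogeneous_in_chart.
- move=> q i Uq; apply: (differentiable_comp (f := m c) (g := fun w => w 0 i)).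
    exact: (sm [::]).
  exact: differentiable_coord.
- by move=> q; exact: uF.
- by move=> q /frame[].
- by move=> q i j /frame[_]; exact.
Qed.

End Surface.

Theorem corollary4p13 (R : realType) (M : topologicalType)
    (S : smooth_surface R M) (A : set (tangent R M))
    (F phi : tangent R M -> R)
    (eps : chart S -> pt R -> R) (m : chart S -> pt R -> 'rV[R]_2) :
  conic_subbundle S A ->
  conic_pseudo_finsler S A F ->
  berwald_frame A F eps m ->
  anisotropic_conformal_change A F eps m phi ->
  proper_change A F m phi ->
  (landsberg A F m ->
   vertical_T_condition A F m phi ->
   berwaldian A F m)
  /\
  (landsberg A (conformal_change F phi) (changed_m F eps m phi) ->
   vertical_T_condition A (conformal_change F phi) (changed_m F eps m phi) phi ->
   berwaldian A (conformal_change F phi) (changed_m F eps m phi)).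
Proof.
move=> hA hF hm [sphi hphi N0] proper.
have B c := berwald_chart_in_chart c hA hF hm.
have hphic (c : chart S) : homogeneous_on (set_in_chart c A) 0 (in_chart c phi).
  exact: homogeneous_in_chart.
have dphi c q i : set_in_chart c A q -> d_y i (in_chart c phi) q =
    vder2 (in_chart c F) (m c) (in_chart c phi) q / in_chart c F q * m c q 0 i.
  move=> Uq; apply: (mulfI (F_neq0 (B c) Uq)).
  rewrite (F_d_y_phi (B c) (sphi c) (hphic c) i Uq).
  by rewrite [in RHS]mulrA [in RHS]mulrCA divff ?mulr1// (F_neq0 (B c) Uq).
split=> L T c q Uq; split; try exact: L.
  apply: (berwald_of_landsberg (B c) _ (T c) (L c) Uq) => p Up.
  exists (vder2 (in_chart c F) (m c) (in_chart c phi) p / in_chart c F p).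
    by rewrite mulf_neq0 ?proper ?invr_neq0// (F_neq0 (B c) Up).
  by move=> i; exact: dphi.
have N0c p : set_in_chart c A p ->
    sigma (in_chart c F) (eps c) (m c) (in_chart c phi) p + eps c p
    - vder2 (in_chart c F) (m c) (in_chart c phi) p ^+ 2 != 0.
  by move=> Up; rewrite [X in X - _]addrC; exact: N0.
have Bbar := berwald_chart_conformal (B c) (sphi c) (hphic c) N0c.
apply: (berwald_of_landsberg Bbar _ (T c) (L c) Uq) => p Up.
have k0 : kappa (in_chart c F) (eps c) (m c) (in_chart c phi) p != 0.
  by rewrite gt_eqF// (kappa_gt0 (B c) N0c Up).
exists (vder2 (in_chart c F) (m c) (in_chart c phi) p / in_chart c F p /
  kappa (in_chart c F) (eps c) (m c) (in_chart c phi) p).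
  by rewrite !mulf_neq0 ?proper ?invr_neq0// (F_neq0 (B c) Up).
by move=> i; rewrite m_barE mulrA divfK//; exact: dphi.
Qed.
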